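(* Let $I\subset\mathbb R$ be an interval, let $h\in C^\infty(I)$, and consider the family of lines $L_t:\ y=tx+h(t)$, $t\in I$. Let $\Psi(u,v)$, $u\neq v$, be the intersection point of $L_u$ and $L_v$, let $J_\Psi$ be the Jacobian determinant of $\Psi$, and set $S_h(u,v):=\partial_u\partial_v\log|J_\Psi(u,v)|$. Let $t_0\in I$ satisfy $h''(t_0)\neq 0$. Then there are a neighborhood $W$ of $(t_0,t_0)$ in $I\times I$ and a smooth function $R_h:W\to\mathbb R$ (smooth across the diagonal) such that, for all $(u,v)\in W$ with $u\neq v$, $$S_h(u,v)=\frac{1}{(v-u)^2}+R_h(u,v).$$ Moreover, for all $(t,t)\in W$ (that is, for $t$ near $t_0$), the diagonal value of $R_h$ is $$R_h(t,t)=\frac{h^{(4)}(t)}{3h''(t)}-\frac49\left(\frac{h'''(t)}{h''(t)}\right)^2.$$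
   Context: For $u\neq v$ in $I$, the intersection point of $L_u$ and $L_v$ is $$\Psi(u,v)=(x(u,v),y(u,v))=\left(\frac{h(v)-h(u)}{u-v},\ \frac{u\,h(v)-v\,h(u)}{u-v}\right),$$ and $J_\Psi=x_uy_v-x_vy_u$. The function $S_h$ is defined at points off the diagonal at which $J_\Psi\neq0$; the asserted identity for $S_h$ includes the assertion that $S_h$ is defined at all off-diagonal points of $W$. The neighborhood $W$ is understood to be small enough that $h''(t)\ne 0$ whenever $(t,t)\in W$. *)

(* Defs.v *)
From HB Require Import structures.
From mathcomp Require Import all_boot all_order all_algebra.
From mathcomp Require Import all_classical all_reals all_analysis.
From mathcomp Require Import ring lra.

Set Implicit Arguments.
Unset Strict Implicit.
Unset Printing Implicit Defensive.

Import Order.TTheory GRing.Theory Num.Theory.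
Import numFieldNormedType.Exports.

Local Open Scope classical_set_scope.
Local Open Scope ring_scope.

(* Intervals may contain their endpoints, so derivatives are taken within a
   set D: only increments staying in D are considered. The derivative is
   one-sided at an endpoint and is [derive1] at an interior point
   (lemmas [derivable1_in_interior] and [derive1_in_interior] below). As usual
   with [lim], [derive1_in] is meaningful only where [derivable1_in] holds. *)
Definition derivable1_in (R : realType) (D : set R) (f : R -> R) (t : R) : Prop :=
  cvg ((fun s => (f s - f t) / (s - t)) @ within D t^').

Definition derive1_in (R : realType) (D : set R) (f : R -> R) (t : R) : R :=
  lim ((fun s => (f s - f t) / (s - t)) @ within D t^').

Definition derive1n_in (R : realType) (D : set R) (n : nat) (f : R -> R) : R -> R :=
  iter n (derive1_in D) f.

Definition smooth_in (R : realType) (D : set R) (f : R -> R) : Prop :=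
  forall (n : nat) (t : R), D t -> derivable1_in D (derive1n_in D n f) t.

Definition derivable_fst_in (R : realType) (D : set (R * R)) (f : R * R -> R)
    (p : R * R) : Prop :=
  derivable1_in [set s | D (s, p.2)] (fun s => f (s, p.2)) p.1.

Definition derivable_snd_in (R : realType) (D : set (R * R)) (f : R * R -> R)
    (p : R * R) : Prop :=
  derivable1_in [set s | D (p.1, s)] (fun s => f (p.1, s)) p.2.

Definition partial_fst (R : realType) (D : set (R * R)) (f : R * R -> R)
    (p : R * R) : R :=
  derive1_in [set s | D (s, p.2)] (fun s => f (s, p.2)) p.1.

Definition partial_snd (R : realType) (D : set (R * R)) (f : R * R -> R)
    (p : R * R) : R :=
  derive1_in [set s | D (p.1, s)] (fun s => f (p.1, s)) p.2.

(* All iterated partial derivatives of order at most k, in every order of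
   differentiation, exist on D and are jointly continuous on D. This is meant
   for D relatively open in a product of two nondegenerate intervals. *)
Fixpoint Ck_in2 (R : realType) (D : set (R * R)) (k : nat) (f : R * R -> R)
    {struct k} : Prop :=
  {within D, continuous f} /\
  match k with
  | 0%N => True
  | k'.+1 =>
      [/\ forall p, D p -> derivable_fst_in D f p /\ derivable_snd_in D f p,
          Ck_in2 D k' (partial_fst D f)
        & Ck_in2 D k' (partial_snd D f)]
  end.

Definition smooth_in2 (R : realType) (D : set (R * R)) (f : R * R -> R) : Prop :=
  forall k : nat, Ck_in2 D k f.

Definition offdiag (R : realType) (A : set R) : set (R * R) :=
  [set p | [/\ A p.1, A p.2 & p.1 != p.2]].

Definition line (R : realType) (h : R -> R) (t : R) : set (R * R) :=
  [set z | z.2 = t * z.1 + h t].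

Definition Psi_x (R : realType) (h : R -> R) (p : R * R) : R :=
  (h p.2 - h p.1) / (p.1 - p.2).

Definition Psi_y (R : realType) (h : R -> R) (p : R * R) : R :=
  (p.1 * h p.2 - p.2 * h p.1) / (p.1 - p.2).

Definition Psi (R : realType) (h : R -> R) (p : R * R) : R * R :=
  (Psi_x h p, Psi_y h p).

Definition Psi_derivable (R : realType) (A : set R) (h : R -> R) (p : R * R) : Prop :=
  [/\ derivable_fst_in (offdiag A) (Psi_x h) p,
      derivable_snd_in (offdiag A) (Psi_x h) p,
      derivable_fst_in (offdiag A) (Psi_y h) p
    & derivable_snd_in (offdiag A) (Psi_y h) p].

Definition J_Psi (R : realType) (A : set R) (h : R -> R) (p : R * R) : R :=
  partial_fst (offdiag A) (Psi_x h) p * partial_snd (offdiag A) (Psi_y h) p -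
  partial_snd (offdiag A) (Psi_x h) p * partial_fst (offdiag A) (Psi_y h) p.

Definition log_J (R : realType) (A : set R) (h : R -> R) (p : R * R) : R :=
  ln `|J_Psi A h p|.

Definition S_h (R : realType) (A : set R) (h : R -> R) (p : R * R) : R :=
  partial_fst (offdiag A) (partial_snd (offdiag A) (log_J A h)) p.

(* [log_J] and its partial derivative in v must make sense at all
   off-diagonal points near p for the outer derivative in u to be taken. *)
Definition S_h_defined (R : realType) (A : set R) (h : R -> R) (p : R * R) : Prop :=
  [/\ offdiag A p, J_Psi A h p != 0,
      \forall q \near within (offdiag A) (nbhs p),
        [/\ Psi_derivable A h q, J_Psi A h q != 0
          & derivable_snd_in (offdiag A) (log_J A h) q]
    & derivable_fst_in (offdiag A) (partial_snd (offdiag A) (log_J A h)) p].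

Lemma line_inter (R : realType) (h : R -> R) (u v : R) : u != v ->
  line h u `&` line h v = [set Psi h (u, v)].
Proof.
move=> uv; have d0 : u - v != 0 by rewrite subr_eq0.
rewrite /Psi /Psi_x /Psi_y /=; apply/seteqP; split => [[x y]|z] /=.
  rewrite /line /= => -[-> e].
  have ex : x = (h v - h u) / (u - v).
    by apply: (mulIf d0); rewrite divfK// mulrBr [x * u]mulrC [x * v]mulrC; lra.
  by rewrite ex; congr pair; field.
by move=> ->; rewrite /line /=; split; field.
Qed.

Lemma increment_in_interior (R : realType) (D : set R) (f : R -> R) (t : R) :
  D° t ->
  (fun s => (f s - f t) / (s - t)) @ within D t^' =
  (fun e => e^-1 *: (f (e + t) - f t)) @ 0^'.
Proof.
move=> /nbhs_ballP[d /= d0 dD]; apply/seteqP.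
split => P /= /nbhs_ballP[e /= e0 eP]; apply/nbhs_ballP.
- exists (Num.min d e); first by rewrite /= lt_min d0 e0.
  move=> z; rewrite /ball /= sub0r normrN lt_min => /andP[zd ze] z0.
  have tz x : `|z| < x -> ball t x (z + t).
    by rewrite /ball /= opprD addrCA subrr addr0 normrN.
  have nz : z + t != t by rewrite -subr_eq0 addrK.
  by have /= := eP _ (tz _ ze) nz (dD _ (tz _ zd)); rewrite addrK mulrC.
- exists e => // z; rewrite /ball /= => ze nz Dz.
  have b0 : ball 0 e (z - t) by rewrite /ball /= sub0r opprB.
  have := eP _ b0; rewrite subr_eq0 /= => /(_ nz).
  by rewrite subrK /= mulrC.
Qed.

Lemma derivable1_in_interior (R : realType) (D : set R) (f : R -> R) (t : R) :
  D° t -> derivable1_in D f t = derivable f t 1.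
Proof.
move=> Dt; rewrite /derivable1_in increment_in_interior// /derivable.
by under [in RHS]eq_fun do rewrite [_ *: 1]mulr1.
Qed.

Lemma derive1_in_interior (R : realType) (D : set R) (f : R -> R) (t : R) :
  D° t -> derive1_in D f t = derive1 f t.
Proof. by move=> Dt; rewrite /derive1_in increment_in_interior// derive1E. Qed.

(* Main.v *)
Require Import Defs.
From mathcomp Require Import all_boot all_order all_algebra.
From mathcomp Require Import all_classical all_reals all_analysis.
From mathcomp Require Import ring lra.

Set Implicit Arguments.
Unset Strict Implicit.
Unset Printing Implicit Defensive.

Import Order.TTheory GRing.Theory Num.Theory.
Import numFieldNormedType.Exports.

Local Open Scope classical_set_scope.
Local Open Scope ring_scope.

(** Let h[u^a, v^b] be the divided difference of h with the node u repeated a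
times and the node v repeated b times. The intersection point of the lines L_u
and L_v has abscissa x = - h[u, v]. Since its ordinate is u x + h(u) and also
v x + h(v), the Jacobian of the intersection map is
   J = - (v - u) x_u x_v = - (v - u) h[u^2, v] h[u, v^2].
The two divided differences extend continuously to the diagonal with value
h''(t) / 2, so they do not vanish near (t0, t0). There log |J| is
log |v - u|, whose mixed derivative is 1 / (v - u)^2, plus the logarithms of
two nonvanishing smooth functions, whose mixed derivatives add up to R_h.
Differentiating repeats a node,
   d/du h[u^a, v^b] = a h[u^(a+1), v^b],
so R_h is a rational expression in divided differences, and its diagonal value
follows from h[t^(n+1)] = h^(n)(t) / n!.

What has to be proved is that divided differences are smooth across the
diagonal, in the one-sided sense at the endpoints of I. The mean value property
h[u^a, v^b] = h^(a+b-1)(xi) / (a+b-1)! with xi between u and v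
([cdd_mean]) gives continuity on the diagonal ([cdd_cvg]). The rule for the
partial derivatives is algebra off the diagonal, and the mean value theorem
carries it to the diagonal ([has_derive_in_extend], [cdd_derive_fst]). As the
partial derivatives of divided differences are multiples of divided
differences, the rational expressions in them form a family closed under
partial differentiation, and every member of such a family is smooth
([rational_closure_smooth]). *)

(** * Derivatives relative to a set *)

(** The limit l of the increment quotients is an argument, so that the rules of
calculus need no existence hypothesis and hold also where D does not accumulate
at t. *)
Definition has_derive_in (R : realType) (D : set R) (f : R -> R) (t l : R) : Prop :=
  (fun s => (f s - f t) / (s - t)) @ within D t^' --> l.

Section RelativeDerivative.
Variable R : realType.
Implicit Types (D : set R) (f g : R -> R) (t l m : R).

Lemma limit_point_within D t : limit_point D t -> ProperFilter (within D t^').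
Proof.
move=> Dt; apply: Build_ProperFilter_ex => P.
rewrite /within /= => /(Dt _) [y [yt Dy yP]].
by exists y; apply: yP.
Qed.

Lemma limit_point_near D D' t : limit_point D t ->
  (\forall s \near t, D s -> D' s) -> limit_point D' t.
Proof.
move=> Dt DD' U tU; have [y [yt Dy [Uy DD'y]]] := Dt _ (filterI tU DD').
by exists y; split=> //; apply: DD'y.
Qed.

(** Derivatives relative to a nondegenerate interval are unique, also at its
endpoints. *)
Lemma limit_point_interval D t : is_interval D -> D° !=set0 -> D t ->
  limit_point D t.
Proof.
move=> Dint [c /nbhs_ballP[e /= e0 cD]] Dt.
(* Some point of D differs from t, and the segment from t to it lies in D. *)
have [w Dw wt] : exists2 w, D w & w != t.
  have [ct|ct] := eqVneq c t; last by exists c => //; apply/cD/ballxx.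
  exists (c + e / 2); last first.
    by rewrite ct -subr_eq0 [t + _]addrC addrK gt_eqF// divr_gt0.
  apply: cD; rewrite /ball /= opprD addrA subrr add0r normrN gtr0_norm ?divr_gt0//.
  by rewrite ltr_pdivrMr// ltr_pMr// ltr1n.
move=> U /nbhs_ballP[d /= d0 dU].
have nwt : 0 < `|w - t| by rewrite normr_gt0 subr_eq0.
pose k := Num.min 1 (d / 2 / `|w - t|).
have k0 : 0 < k by rewrite lt_min ltr01 !divr_gt0.
have k1 : k <= 1 by rewrite ge_min lexx.
have kd : k * `|w - t| < d.
  apply: (@le_lt_trans _ _ (d / 2)); last lra.
  by rewrite -ler_pdivlMr// ge_min lexx orbT.
exists (t + k * (w - t)); split.
- by rewrite -subr_eq0 [t + _]addrC addrK mulf_neq0 ?subr_eq0// gt_eqF.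
- have [tw|tw|tw] := ltgtP t w.
  + by apply: (Dint t w) => //; apply/andP; split; nra.
  + by apply: (Dint w t) => //; apply/andP; split; nra.
  + by move: wt; rewrite tw eqxx.
- apply: dU; rewrite /ball /= opprD addrA subrr add0r normrN normrM.
  by rewrite (gtr0_norm k0).
Qed.

Lemma has_derive_inP D f t l : limit_point D t -> has_derive_in D f t l ->
  derivable1_in D f t /\ derive1_in D f t = l.
Proof.
move=> /limit_point_within PF Df; split.
  by apply/cvg_ex; exists l.
by apply/cvg_lim => //; exact: Rhausdorff.
Qed.

Lemma derivable1_inP D f t :
  derivable1_in D f t -> has_derive_in D f t (derive1_in D f t).
Proof. exact. Qed.

(** The derivative passes to any set that is locally smaller: from an interval
to the slices of a punctured or relatively open product of intervals. *)
Lemma has_derive_in_local D D' f g t l : f t = g t -> has_derive_in D f t l ->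
  (\forall s \near t, D' s -> D s /\ f s = g s) -> has_derive_in D' g t l.
Proof.
move=> ft Df E P lP; apply: filterS2 E (Df P lP) => s E fP st D's /=.
by have [Ds <-] := E D's; rewrite -ft; exact: fP.
Qed.

Lemma within_dnbhs_cvg D t : within D t^' --> within D (nbhs t).
Proof.
by move=> P; apply: (filterS (F := nbhs t) (P := fun s => D s -> P s)) => s Ps _.
Qed.

Lemma within_nbhs_cvg D t : within D t^' --> t.
Proof. by move=> P; apply: (filterS (F := nbhs t)) => s Ps _ _. Qed.

Lemma eq_cvg_within_dnbhs D t f g l : (forall s, s != t -> f s = g s) ->
  f @ within D t^' --> l -> g @ within D t^' --> l.
Proof.
move=> fg fl P lP; apply: (filterS (F := nbhs t)) (fl P lP) => s Ps st Ds /=.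
by rewrite -fg//; exact: Ps.
Qed.

Lemma has_derive_in_cvg D f t l : has_derive_in D f t l ->
  f @ within D (nbhs t) --> f t.
Proof.
move=> Df.
have tt : (fun s => s - t) @ within D t^' --> (0 : R).
  rewrite -(subrr t); apply: cvgB; last exact: cvg_cst.
  exact: within_nbhs_cvg.
have cf : f @ within D t^' --> f t.
  have H : (fun s => (f s - f t) / (s - t) * (s - t) + f t) @ within D t^' --> 0 + f t.
    by apply: cvgD; [rewrite -(mulr0 l); exact: cvgM|exact: cvg_cst].
  rewrite add0r in H; apply: eq_cvg_within_dnbhs H => s st.
  by rewrite divfK ?subr_eq0// subrK.
move=> P fP; apply: (filterS (F := nbhs t)) (cf P fP) => s H Ds /=.
have [->|st] := eqVneq s t.
  exact: nbhs_singleton.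
exact: H.
Qed.

Lemma has_derive_in_cst D t (k : R) : has_derive_in D (fun=> k) t 0.
Proof.
by apply: eq_cvg_within_dnbhs (cvg_cst (0 : R)) => s _; rewrite subrr mul0r.
Qed.

Lemma has_derive_in_id D t : has_derive_in D id t 1.
Proof.
by apply: eq_cvg_within_dnbhs (cvg_cst (1 : R)) => s st; rewrite divff// subr_eq0.
Qed.

Lemma has_derive_inD D f g t l m : has_derive_in D f t l -> has_derive_in D g t m ->
  has_derive_in D (fun s => f s + g s) t (l + m).
Proof.
move=> Df Dg; apply: eq_cvg_within_dnbhs (cvgD Df Dg) => s _.
by rewrite fctE -mulrDl; congr (_ / _); ring.
Qed.

Lemma has_derive_inM D f g t l m : has_derive_in D f t l -> has_derive_in D g t m ->
  has_derive_in D (fun s => f s * g s) t (l * g t + f t * m).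
Proof.
move=> Df Dg.
have cg : g @ within D t^' --> g t.
  by apply: cvg_comp (@within_dnbhs_cvg D t) (has_derive_in_cvg Dg).
have H : (fun s => (f s - f t) / (s - t) * g s + f t * ((g s - g t) / (s - t)))
    @ within D t^' --> l * g t + f t * m.
  by apply: cvgD; apply: cvgM => //; exact: cvg_cst.
by apply: eq_cvg_within_dnbhs H => s _; rewrite /=; ring.
Qed.

Lemma has_derive_in_scale D (k : R) f t l : has_derive_in D f t l ->
  has_derive_in D (fun s => k * f s) t (k * l).
Proof.
move=> Df; have := has_derive_inM (has_derive_in_cst D t k) Df.
by rewrite mul0r add0r.
Qed.

Lemma has_derive_inN D f t l : has_derive_in D f t l ->
  has_derive_in D (fun s => - f s) t (- l).
Proof.
move=> Df; have := has_derive_in_scale (k := -1) Df.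
by under eq_fun do rewrite mulN1r; rewrite mulN1r.
Qed.

Lemma has_derive_inB D f g t l m : has_derive_in D f t l -> has_derive_in D g t m ->
  has_derive_in D (fun s => f s - g s) t (l - m).
Proof. by move=> Df Dg; apply: has_derive_inD Df (has_derive_inN Dg). Qed.

Lemma has_derive_inX D f t l n : has_derive_in D f t l ->
  has_derive_in D (fun s => f s ^+ n.+1) t (n.+1%:R * f t ^+ n * l).
Proof.
move=> Df; elim: n => [|n IH]; first by rewrite mulr1 mul1r.
under eq_fun do rewrite exprSr.
have := has_derive_inM IH Df.
by congr has_derive_in; rewrite -[n.+2%:R]natr1 exprSr; ring.
Qed.

(** The slope of g at f t, extended by its limit m, is continuous at f t even
though f may take the value f t at other points; this is Caratheodory's form of
the chain rule. *)
Lemma has_derive_in_comp D f g t l m : has_derive_in D f t l ->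
  is_derive (f t) 1 g m -> has_derive_in D (fun s => g (f s)) t (m * l).
Proof.
move=> Df [dg gm].
have Dg : has_derive_in setT g (f t) m.
  have it : (@setT R)° (f t) by rewrite interiorT.
  rewrite -gm -derive1E -(derive1_in_interior g it); apply: derivable1_inP.
  by rewrite (derivable1_in_interior g it).
pose slope y := if y == f t then m else (g y - g (f t)) / (y - f t).
have cs : slope @ f t --> m.
  move=> P mP; apply: (filterS (F := nbhs (f t))) (Dg P mP) => y Hy /=.
  rewrite /slope; case: eqVneq => [_|yt].
    exact: nbhs_singleton.
  exact: Hy.
have cf : f @ within D t^' --> f t.
  by apply: cvg_comp (@within_dnbhs_cvg D t) (has_derive_in_cvg Df).
have H : (fun s => slope (f s) * ((f s - f t) / (s - t))) @ within D t^' --> m * l.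
  by apply: cvgM => //; exact: cvg_comp cf cs.
apply: eq_cvg_within_dnbhs H => s _; rewrite /= /slope.
case: eqVneq => [->|st]; first by rewrite !subrr !(mul0r, mulr0).
by rewrite mulrA divfK// subr_eq0.
Qed.

Lemma has_derive_inV D f t l : f t != 0 -> has_derive_in D f t l ->
  has_derive_in D (fun s => (f s)^-1) t (- l / f t ^+ 2).
Proof.
move=> ft0 Df.
have := has_derive_in_comp Df (is_deriveV ft0 (is_derive_id (f t) 1)).
by congr has_derive_in; rewrite /GRing.scale /= mulr1 mulNr mulrC mulNr.
Qed.

Lemma has_derive_in_div D f g t l m : g t != 0 ->
  has_derive_in D f t l -> has_derive_in D g t m ->
  has_derive_in D (fun s => f s / g s) t ((l - f t / g t * m) / g t).
Proof.
move=> gt0 Df Dg; have := has_derive_inM Df (has_derive_inV gt0 Dg).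
by congr has_derive_in; field.
Qed.

Lemma has_derive_in_ln_norm D f t l : f t != 0 -> has_derive_in D f t l ->
  has_derive_in D (fun s => ln `|f s|) t (l / f t).
Proof.
move=> ft0 Df; rewrite [l / _]mulrC.
have pos g k : 0 < g t -> has_derive_in D g t k ->
    has_derive_in D (fun s => ln `|g s|) t ((g t)^-1 * k).
  move=> gt0 Dg.
  apply: has_derive_in_local (has_derive_in_comp Dg (is_derive1_ln gt0)) _.
    by rewrite gtr0_norm.
  apply: (filterS (F := nbhs t)) (cvgr_gt _ (has_derive_in_cvg Dg) _ gt0) => s H Ds.
  by split=> //; rewrite gtr0_norm//; exact: H.
have [ft|ft|/eqP] := ltgtP (f t) 0; last by rewrite (negbTE ft0).
  have := pos (fun s => - f s) (- l); rewrite oppr_gt0 => /(_ ft (has_derive_inN Df)).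
  by rewrite invrN mulrNN; under eq_fun do rewrite normrN.
exact: pos.
Qed.

Lemma MVT_in D f (df : R -> R) u v : is_interval D -> D u -> D v -> u < v ->
  (forall x, u <= x <= v -> f @ within D (nbhs x) --> f x) ->
  (forall x, u < x < v -> has_derive_in D f x (df x)) ->
  exists2 x, u < x < v & f v - f u = df x * (v - u).
Proof.
move=> Dint Du Dv uv cf Df.
have uvD x : u <= x <= v -> D x by exact: Dint.
have itv_bound x : u < x < v -> u <= x <= v by case/andP => /ltW -> /ltW ->.
have [| |x] := @MVT R f df u v uv.
- move=> x; rewrite in_itv /= => uxv.
  have Dx : D° x.
    have /= := near_in_itvoo (a := u) (b := v) (x := x).
    rewrite in_itv /= => /(_ uxv); apply: filterS => y; rewrite in_itv /=.
    by case/andP=> uy yv; apply: uvD; rewrite !ltW.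
  have [d e] := has_derive_inP (limit_point_interval Dint (ex_intro _ x Dx)
    (uvD x (itv_bound x uxv))) (Df x uxv).
  apply: DeriveDef; first by rewrite -(derivable1_in_interior _ Dx).
  by rewrite -derive1E -(derive1_in_interior _ Dx).
- apply/subspace_continuousP => x; rewrite /= in_itv /= => uxv.
  apply: cvg_trans (cf x uxv) => P.
  apply: (filterS (F := nbhs x)) => y H /=.
  by rewrite in_itv /= => /uvD; exact: H.
- by rewrite in_itv /= => uxv e; exists x.
Qed.

End RelativeDerivative.

(** * Mean values within an interval *)

Section MeanValue.
Variable R : realType.
Implicit Types (D : set R) (f : R -> R) (t u v : R).

Lemma MVT_between D f (df : R -> R) u v : is_interval D -> D u -> D v -> u != v ->
  (forall x, D x -> f @ within D (nbhs x) --> f x) ->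
  (forall x, Num.min u v < x < Num.max u v -> has_derive_in D f x (df x)) ->
  exists2 x, Num.min u v < x < Num.max u v & f v - f u = df x * (v - u).
Proof.
move=> Dint Du Dv; rewrite neq_lt => /orP[uv|vu] cf Df.
  rewrite (min_l (ltW uv)) (max_r (ltW uv)) in Df *.
  by apply: (MVT_in Dint) => // x /(Dint _ _ Du Dv)/cf.
rewrite (min_r (ltW vu)) (max_l (ltW vu)) in Df *.
have [|x vxu e] := MVT_in Dint Dv Du vu _ Df.
  by move=> x /(Dint _ _ Dv Du)/cf.
by exists x => //; rewrite -opprB e -mulrN opprB.
Qed.

Lemma interval_between D u v x : is_interval D -> D u -> D v ->
  Num.min u v <= x <= Num.max u v -> D x.
Proof.
move=> Dint Du Dv; case: (leP u v) => [uv|/ltW vu]; first exact: Dint.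
exact: Dint.
Qed.

Lemma ball_between t u v x (e : R) : ball t e u -> ball t e v ->
  Num.min u v <= x <= Num.max u v -> ball t e x.
Proof.
have Dint : is_interval (ball t e).
  move=> y z ty tz w /andP[yw wz]; move: ty tz.
  rewrite /ball /= !ltr_distlC => /andP[ty _] /andP[_ zt].
  by apply/andP; split; lra.
exact: interval_between.
Qed.

(** A derivative that is known off a point and has a limit there is the
derivative there too: by the mean value theorem every increment quotient at t
is a nearby value of g. *)
Lemma has_derive_in_extend D f (g : R -> R) t : is_interval D -> D t ->
  (forall x, D x -> f @ within D (nbhs x) --> f x) ->
  (forall x, D x -> x != t -> has_derive_in D f x (g x)) ->
  g @ within D (nbhs t) --> g t -> has_derive_in D f t (g t).
Proof.
move=> Dint Dt cf Df cg P gP.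
have /nbhs_ballP[e /= e0 eP] := cg P gP.
apply/nbhs_ballP; exists e => // s ts st Ds /=.
rewrite eq_sym in st.
have [|x /andP[x1 x2] E] := MVT_between (df := g) Dint Dt Ds st cf _.
  move=> x /andP[x1 x2]; apply: Df.
    by apply: (interval_between Dint Dt Ds); rewrite !ltW.
  apply/eqP => xt; move: x1 x2; rewrite xt gt_min lt_max !ltxx /=.
  by move=> /lt_trans h /h; rewrite ltxx.
rewrite E mulfK; last by rewrite subr_eq0 eq_sym.
have xb : Num.min t s <= x <= Num.max t s by rewrite !ltW.
apply: eP; first by apply: ball_between xb => //; exact: ballxx.
exact: (interval_between Dint Dt Ds).
Qed.

End MeanValue.

(** * Products of sets and their slices *)

Definition cvg_in2 (R : realType) (D : set (R * R)) (f : R * R -> R) (p : R * R) : Prop :=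
  f @ within D (nbhs p) --> f p.

Section Slices.
Variable R : realType.
Implicit Types (D E : set R) (u v : R).

Lemma within_fst_cvg D E u v :
  fst @ within (D `*` E) (nbhs (u, v)) --> within D (nbhs u).
Proof.
move=> P /nbhs_ballP[e /= e0 eP].
by apply/nbhs_ballP; exists e => // -[x y] [/= ux _] [/= Dx _]; exact: eP.
Qed.

Lemma within_snd_cvg D E u v :
  snd @ within (D `*` E) (nbhs (u, v)) --> within E (nbhs v).
Proof.
move=> P /nbhs_ballP[e /= e0 eP].
by apply/nbhs_ballP; exists e => // -[x y] [/= _ vy] [/= _ Ey]; exact: eP.
Qed.

Lemma slice_fst_cvg D E u v : E v ->
  (fun s => (s, v)) @ within D (nbhs u) --> within (D `*` E) (nbhs (u, v)).
Proof.
move=> Ev P; rewrite /within /= => /nbhs_ballP[e /= e0 eP].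
apply/nbhs_ballP; exists e => // x ux Dx.
by apply: eP; split => //=; exact: ballxx.
Qed.

End Slices.

(** * Confluent divided differences *)

(** If c n is the n-th derivative of f divided by n!, then cdd c a b u v is the
divided difference f[u^a, v^b], by Newton's recursion. The sequence c is taken
as data because the diagonal values involve all of it. The value 0 without any
node keeps the definition symmetric and cancels from [cdd_translate]. *)
Fixpoint cdd (R : realType) (c : nat -> R -> R) (a b : nat) (u v : R) : R :=
  match a with
  | 0 => if b is b'.+1 then c b' v else 0
  | a'.+1 =>
      (fix cdd_snd b := match b with
        | 0 => c a' u
        | b'.+1 => if u == v then c (a' + b').+1 u
                   else (cdd c a' b'.+1 u v - cdd_snd b') / (v - u)
        end) b
  end.

Definition taylor_coefs (R : realType) (D : set R) (c : nat -> R -> R) : Prop :=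
  forall n t, D t -> has_derive_in D (c n) t (n.+1%:R * c n.+1 t).

(** The coefficients of the derivative of the function with coefficients c. *)
Definition deriv_coefs (R : realType) (c : nat -> R -> R) : nat -> R -> R :=
  fun n t => n.+1%:R * c n.+1 t.

Section DividedDifferences.
Variables (R : realType) (D : set R).
Hypothesis D_interval : is_interval D.
Implicit Types (c : nat -> R -> R) (a b n : nat) (u v t x : R).

Lemma cdd_diag c a b t : cdd c a.+1 b.+1 t t = c (a + b).+1 t.
Proof. by rewrite /= eqxx. Qed.

Lemma cddSS c a b u v : u != v ->
  cdd c a.+1 b.+1 u v = (cdd c a b.+1 u v - cdd c a.+1 b u v) / (v - u).
Proof. by move=> /negbTE /= ->. Qed.

Arguments cdd : simpl never.

Lemma cdd_sym c a b u v : cdd c a b u v = cdd c b a v u.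
Proof.
have [->|uv] := eqVneq u v; first by case: a b => [|a] [|b] //; rewrite !cdd_diag addnC.
elim: a b => [|a IHa]; elim=> [|b IHb] //.
rewrite (cddSS c a b)// (cddSS c b a) 1?eq_sym// IHa IHb.
by rewrite -opprB -[v - u]opprB invrN mulrNN.
Qed.

Lemma taylor_coefs_deriv c : taylor_coefs D c -> taylor_coefs D (deriv_coefs c).
Proof. by move=> Dc n t Dt; apply: has_derive_in_scale; exact: Dc. Qed.

(** Translating both nodes together differentiates the function: the left side
is the derivative of the divided difference along (1, 1). *)
Lemma cdd_translate c a b u v : u != v ->
  a%:R * cdd c a.+1 b u v + b%:R * cdd c a b.+1 u v = cdd (deriv_coefs c) a b u v.
Proof.
move=> uv; elim: a b => [|a IHa] b.
  by case: b => [|b]; rewrite mul0r add0r ?mul0r.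
elim: b => [|b IHb]; first by rewrite mul0r addr0.
have vu : v - u != 0 by rewrite subr_eq0 eq_sym.
rewrite [RHS]cddSS// -IHa -IHb (cddSS c a.+1)// (cddSS c a b.+1)// (cddSS c a b)//.
by rewrite -!natr1; field.
Qed.

(** Differentiating Newton's recursion reproduces it with the node u repeated
once more. *)
Lemma cdd_derive_fst_offdiag c a b u v : taylor_coefs D c -> D u -> u != v ->
  has_derive_in D (fun s => cdd c a b s v) u (a%:R * cdd c a.+1 b u v).
Proof.
move=> Dc Du uv; have vu : v - u != 0 by rewrite subr_eq0 eq_sym.
elim: a b => [|a IHa] b; first by rewrite mul0r; exact: has_derive_in_cst.
elim: b => [|b IHb]; first exact: Dc.
have Dq := has_derive_in_div (g := fun s => v - s) vu (has_derive_inB (IHa b.+1) IHb)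
  (has_derive_inB (has_derive_in_cst D u v) (has_derive_in_id D u)).
have -> : a.+1%:R * cdd c a.+2 b.+1 u v =
   (a%:R * cdd c a.+1 b.+1 u v - a.+1%:R * cdd c a.+2 b u v -
   (cdd c a b.+1 u v - cdd c a.+1 b u v) / (v - u) * (0 - 1)) / (v - u).
  by rewrite (cddSS c a.+1 b uv) -(cddSS c a b uv) -natr1; field.
apply: has_derive_in_local Dq _; first by rewrite cddSS.
have uvn : \forall s \near u, s != v by apply: open_nbhs_nbhs; split=> //; exact: open_neq.
near=> s => Ds; have sv : s != v by near: s.
by split=> //; rewrite -cddSS.
Unshelve. all: by end_near. Qed.

Lemma cdd_derive_snd_offdiag c a b u v : taylor_coefs D c -> D v -> u != v ->
  has_derive_in D (fun s => cdd c a b u s) v (b%:R * cdd c a b.+1 u v).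
Proof.
move=> Dc Dv uv; rewrite cdd_sym; under eq_fun do rewrite cdd_sym.
by apply: cdd_derive_fst_offdiag; rewrite 1?eq_sym.
Qed.

Lemma taylor_coefs_cvg c n t : taylor_coefs D c -> D t ->
  c n @ within D (nbhs t) --> c n t.
Proof. by move=> Dc Dt; exact: has_derive_in_cvg (Dc n t Dt). Qed.

Lemma has_derive_in_shift u x : has_derive_in D (fun s => s - u) x (1 - 0).
Proof. exact: has_derive_inB (has_derive_in_id D x) (has_derive_in_cst D x u). Qed.

Lemma exprB_cvg u x n :
  (fun s => (s - u) ^+ n) @ within D (nbhs x) --> (x - u) ^+ n.
Proof.
case: n => [|n]; first exact: cvg_cst.
exact: has_derive_in_cvg (has_derive_inX (n := n) (has_derive_in_shift u x)).
Qed.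

(** Multiplied by this power of s - u, Newton's recursion has no denominator,
hence the product is continuous at s = u as well; this is the continuity at the
end of the interval that Rolle's theorem requires in [cdd_mean]. *)
Lemma cdd_pow_cvg c a b u x : taylor_coefs D c -> D u -> D x ->
  (fun s => (s - u) ^+ (a + b).-1 * cdd c a b u s) @ within D (nbhs x) -->
  (x - u) ^+ (a + b).-1 * cdd c a b u x.
Proof.
move=> Dc Du Dx; pose F a b s : R := (s - u) ^+ (a + b).-1 * cdd c a b u s.
have cX := @exprB_cvg u x.
have cM n (g : R -> R) : g @ within D (nbhs x) --> g x ->
    (fun s => (s - u) ^+ n * g s) @ within D (nbhs x) --> (x - u) ^+ n * g x.
  by move=> cg; exact: cvgM.
have FE a' b' s : F a'.+1 b'.+1 s = F a' b'.+1 s - F a'.+1 b' s.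
  rewrite /F !addSn !addnS /=; have [<-|us] := eqVneq u s.
    rewrite subrr; case e : (a' + b')%N => [|n]; last first.
      by rewrite !expr0n !mul0r subrr.
    move/eqP: e; rewrite addn_eq0 => /andP[/eqP-> /eqP->].
    by rewrite expr1 expr0 !mul1r mul0r subrr.
  by rewrite cddSS// exprS; field; rewrite subr_eq0 eq_sym.
rewrite -/(F a b x) -/(F a b).
elim: a b => [|a IHa] b.
  by case: b => [|b]; apply: cM; [exact: cvg_cst|exact: taylor_coefs_cvg].
elim: b => [|b IHb]; first by apply: cM; exact: cvg_cst.
have -> : F a.+1 b.+1 = fun s => F a b.+1 s - F a.+1 b s.
  by apply/funext => s; rewrite FE.
exact: cvgB.
Qed.

(** The remainder (x - u) ^ m f[u^(a+1), x^(b+1)], m = a + b + 1, vanishes at x = u and its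
derivative is (x - u) ^ (m - 1) times a divided difference of the derivative,
with one node u fewer; Cauchy's mean value theorem against (x - u) ^ m
thus trades a node for a derivative, until only the node x is left. *)
Lemma cdd_mean c a b u v : taylor_coefs D c -> D u -> D v ->
  exists2 x, Num.min u v <= x <= Num.max u v & cdd c a b.+1 u v = c (a + b)%N x.
Proof.
elim: a c b u v => [|a IH] c b u v Dc Du Dv.
  by exists v => //; rewrite ge_min le_max !lexx !orbT.
have [->|uv] := eqVneq u v.
  by exists v; rewrite ?cdd_diag// ge_min le_max !lexx.
(* psi, with derivative dpsi, vanishes at u and v; by Rolle's theorem the second
factor of dpsi vanishes in between. *)
pose m := (a + b).+1; pose phi x := (x - u) ^+ m * cdd c a.+1 b.+1 u x.
pose psi x := phi x * (v - u) ^+ m - phi v * (x - u) ^+ m.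
pose dpsi x := (x - u) ^+ (a + b) *
  (cdd (deriv_coefs c) a b.+1 u x * (v - u) ^+ m - m%:R * phi v).
have vu : v - u != 0 by rewrite subr_eq0 eq_sym.
have [x Dx|x /andP[x1 x2]|x x12 E] := MVT_between (f := psi) (df := dpsi) D_interval Du Dv uv.
- apply: cvgB; apply: cvgM; try exact: cvg_cst.
    by have := @cdd_pow_cvg c a.+1 b.+1 u x Dc Du Dx; rewrite addSn addnS.
  exact: exprB_cvg.
- have ux : u != x.
    apply/eqP => ux; move: x1 x2; rewrite -ux gt_min lt_max !ltxx /=.
    by move=> /lt_trans h /h; rewrite ltxx.
  have Dx : D x by apply: (interval_between D_interval Du Dv); rewrite !ltW.
  have Dpow := has_derive_inX (n := a + b) (has_derive_in_shift u x).
  have Dphi := has_derive_inM Dpow (@cdd_derive_snd_offdiag c a.+1 b.+1 u x Dc Dx ux).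
  have := has_derive_inB (has_derive_inM Dphi (has_derive_in_cst D x ((v - u) ^+ m)))
    (has_derive_in_scale (k := phi v) Dpow).
  congr has_derive_in; rewrite /dpsi -(cdd_translate c a b.+1 ux) (cddSS c a b.+1 ux).
  by rewrite /m exprS -!natr1 natrD; field; rewrite subr_eq0 eq_sym.
have psi0 : psi v - psi u = 0.
  by rewrite /psi /phi !subrr !expr0n /=; ring.
have xu : x - u != 0.
  rewrite subr_eq0; apply/eqP => ux; case/andP: x12; rewrite ux gt_min lt_max !ltxx /=.
  by move=> /lt_trans h /h; rewrite ltxx.
have xI : Num.min u v <= x <= Num.max u v by case/andP: x12 => /ltW-> /ltW->.
have Dx := interval_between D_interval Du Dv xI.
have [y yI ye] := IH _ b u x (taylor_coefs_deriv Dc) Du Dx.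
exists y.
  case/andP: xI yI; rewrite !ge_min !le_max => x1 x2 /andP[y1 y2]; apply/andP; split; lra.
move: E; rewrite psi0 => /esym/eqP; rewrite mulf_eq0 (negbTE vu) orbF.
rewrite mulf_eq0 expf_eq0 (negbTE xu) andbF /= ye subr_eq0 => /eqP e.
have P0 : (v - u) ^+ m != 0 by rewrite expf_neq0.
have m0 : m%:R != 0 :> R by rewrite pnatr_eq0.
apply: (mulfI m0); apply: (mulIf P0).
by rewrite addSn -/m; move: e; rewrite /deriv_coefs -/m => ->; rewrite /phi; ring.
Qed.

(** On the diagonal, the mean value property bounds the oscillation of the
divided difference by that of c (a + b).+1. *)
Lemma cdd_cvg c a b u v : taylor_coefs D c -> D u -> D v ->
  cvg_in2 (D `*` D) (fun p => cdd c a b p.1 p.2) (u, v).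
Proof.
move=> Dc Du Dv; rewrite /cvg_in2 /=.
have cfst n := cvg_comp _ _ (@within_fst_cvg R D D u v) (@taylor_coefs_cvg c n u Dc Du).
have csnd n := cvg_comp _ _ (@within_snd_cvg R D D u v) (@taylor_coefs_cvg c n v Dc Dv).
elim: a b => [|a IHa]; first by case=> [|b]; [exact: cvg_cst|exact: csnd].
elim=> [|b IHb]; first exact: cfst.
have [uv|uv] := eqVneq u v.
  rewrite -uv in Dv *; rewrite cdd_diag => P cP.
  have /nbhs_ballP[e /= e0 eP] := @taylor_coefs_cvg c (a + b).+1 u Dc Du P cP.
  apply/nbhs_ballP; exists e => // -[x y] [/= ux uy] [/= Dx Dy].
  have [z zxy ->] := @cdd_mean c a.+1 b x y Dc Dx Dy.
  apply: eP; first exact: ball_between zxy.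
  exact: interval_between zxy.
have vu : v - u != 0 by rewrite subr_eq0 eq_sym.
have H : (fun p : R * R => (cdd c a b.+1 p.1 p.2 - cdd c a.+1 b p.1 p.2) / (p.2 - p.1))
    @ within (D `*` D) (nbhs (u, v)) -->
    (cdd c a b.+1 u v - cdd c a.+1 b u v) / (v - u).
  apply: cvgM; first exact: cvgB (IHa _) IHb.
  apply: cvgV => //; apply: cvgB; apply: cvg_within_filter.
    exact: cvg_snd.
  exact: cvg_fst.
rewrite (cddSS c a b uv) => P cP.
(* Balls of radius d around u and v are disjoint. *)
pose d := `|v - u| / 2; have d0 : 0 < d by rewrite divr_gt0 ?normr_gt0.
have /nbhs_ballP[e /= e0 eP] := H P cP.
apply/nbhs_ballP; exists (Num.min d e) => [|[x y] xyb Dxy /=].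
  by rewrite /= lt_min d0.
rewrite cddSS; last first.
  case: xyb => /=; rewrite /ball /= !lt_min => /andP[ux _] /andP[vy _].
  apply/eqP => xy; have := ler_distD x v u; rewrite [`|x - u|]distrC {1}xy.
  by move: ux vy; rewrite xy /d; lra.
by apply: (eP (x, y)) => //; apply: le_ball xyb; rewrite ge_min lexx orbT.
Qed.

(** Partial derivatives of a confluent divided difference repeat a node; on the
diagonal this follows from the off-diagonal case by continuity. *)
Lemma cdd_derive_fst c a b u v : taylor_coefs D c -> D u -> D v ->
  has_derive_in D (fun s => cdd c a.+1 b.+1 s v) u (a.+1%:R * cdd c a.+2 b.+1 u v).
Proof.
move=> Dc Du Dv; have [->|uv] := eqVneq u v; last exact: cdd_derive_fst_offdiag.
have cslice a' b' x : D x ->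
    (fun s => cdd c a' b' s v) @ within D (nbhs x) --> cdd c a' b' x v.
  move=> Dx; exact: cvg_comp _ _ (@slice_fst_cvg R D D x v Dv) (@cdd_cvg c a' b' x v Dc Dx Dv).
apply: (has_derive_in_extend (g := fun s => a.+1%:R * cdd c a.+2 b.+1 s v)) => //.
- by move=> x; exact: cslice.
- by move=> x Dx xv; exact: cdd_derive_fst_offdiag.
- by apply: cvgM; [exact: cvg_cst|exact: cslice].
Qed.

Lemma cdd_derive_snd c a b u v : taylor_coefs D c -> D u -> D v ->
  has_derive_in D (fun s => cdd c a.+1 b.+1 u s) v (b.+1%:R * cdd c a.+1 b.+2 u v).
Proof.
move=> Dc Du Dv; rewrite cdd_sym; under eq_fun do rewrite cdd_sym.
exact: cdd_derive_fst.
Qed.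

End DividedDifferences.

(** * Smooth functions of two variables *)

Definition has_partial_fst (R : realType) (D : set (R * R)) (f : R * R -> R)
    (p : R * R) (l : R) : Prop :=
  has_derive_in [set s | D (s, p.2)] (fun s => f (s, p.2)) p.1 l.

Definition has_partial_snd (R : realType) (D : set (R * R)) (f : R * R -> R)
    (p : R * R) (l : R) : Prop :=
  has_derive_in [set s | D (p.1, s)] (fun s => f (p.1, s)) p.2 l.

Inductive rational_closure (R : realType) (D : set (R * R)) (G : set (R * R -> R)) :
    (R * R -> R) -> Prop :=
| rc_gen f : G f -> rational_closure D G f
| rc_cst (k : R) : rational_closure D G (fun=> k)
| rc_add f g : rational_closure D G f -> rational_closure D G g ->
    rational_closure D G (fun p => f p + g p)
| rc_mul f g : rational_closure D G f -> rational_closure D G g ->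
    rational_closure D G (fun p => f p * g p)
| rc_inv f : rational_closure D G f -> (forall p, D p -> f p != 0) ->
    rational_closure D G (fun p => (f p)^-1).

Definition C1_in_closure (R : realType) (D : set (R * R)) (G : set (R * R -> R))
    (f : R * R -> R) : Prop :=
  (forall p, D p -> cvg_in2 D f p) /\
  exists fu fv, [/\ rational_closure D G fu, rational_closure D G fv &
    forall p, D p -> has_partial_fst D f p (fu p) /\ has_partial_snd D f p (fv p)].

Section RationalClosure.
Variables (R : realType) (D : set (R * R)) (G : set (R * R -> R)).
Hypothesis D_fst : forall p, D p -> limit_point [set s | D (s, p.2)] p.1.
Hypothesis D_snd : forall p, D p -> limit_point [set s | D (p.1, s)] p.2.
Hypothesis G_C1 : forall f, G f -> C1_in_closure D G f.

Lemma rational_closure_C1 f : rational_closure D G f -> C1_in_closure D G f.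
Proof.
elim=> {f} [f /G_C1 //|k
  |f g rf [cf [fu [fv [rfu rfv df]]]] rg [cg [gu [gv [rgu rgv dg]]]]
  |f g rf [cf [fu [fv [rfu rfv df]]]] rg [cg [gu [gv [rgu rgv dg]]]]
  |f rf [cf [fu [fv [rfu rfv df]]]] f0].
- split; first by move=> p _; exact: cvg_cst.
  exists (fun=> 0), (fun=> 0); split; [exact: rc_cst|exact: rc_cst|].
  by move=> p _; split; exact: has_derive_in_cst.
- split; first by move=> p Dp; apply: cvgD; [exact: cf|exact: cg].
  exists (fun p => fu p + gu p), (fun p => fv p + gv p).
  split; [exact: rc_add|exact: rc_add|move=> p Dp].
  have [fp1 fp2] := df p Dp; have [gp1 gp2] := dg p Dp.
  by split; exact: has_derive_inD.
- split; first by move=> p Dp; apply: cvgM; [exact: cf|exact: cg].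
  exists (fun p => fu p * g p + f p * gu p), (fun p => fv p * g p + f p * gv p).
  split; [by apply: rc_add; exact: rc_mul|by apply: rc_add; exact: rc_mul|].
  move=> -[u v] Dp; have [fp1 fp2] := df _ Dp; have [gp1 gp2] := dg _ Dp.
  by split; [exact: has_derive_inM fp1 gp1|exact: has_derive_inM fp2 gp2].
- split; first by move=> p Dp; apply: cvgV; [exact: f0|exact: cf].
  have rinv := rc_inv rf f0.
  exists (fun p => -1 * fu p * ((f p)^-1 * (f p)^-1)),
         (fun p => -1 * fv p * ((f p)^-1 * (f p)^-1)).
  have rd g : rational_closure D G g ->
      rational_closure D G (fun p => -1 * g p * ((f p)^-1 * (f p)^-1)).
    by move=> rg; apply: rc_mul; apply: rc_mul => //; exact: rc_cst.
  split; [exact: rd|exact: rd|move=> -[u v] Dp].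
  have [fp1 fp2] := df _ Dp; have fp0 := f0 _ Dp.
  have e y : -1 * y * ((f (u, v))^-1 * (f (u, v))^-1) = - y / f (u, v) ^+ 2.
    by rewrite mulN1r expr2 invfM.
  by rewrite !e; split; exact: has_derive_inV.
Qed.

Lemma rational_closure_continuous f g : rational_closure D G f ->
  (forall p, D p -> f p = g p) -> {within D, continuous g}.
Proof.
move=> /rational_closure_C1[cf _] fg.
apply/subspace_continuousP => p Dp P gP.
have fP : nbhs (f p) P by rewrite (fg p Dp).
have /nbhs_ballP[e /= e0 eP] := cf p Dp P fP.
apply/nbhs_ballP; exists e => // q pq Dq /=.
have fq : P (f q) by exact: eP.
by rewrite (fg q Dq) in fq.
Qed.

(** Iterated partial derivatives of a member of the family stay in the family,
so it suffices that members are continuous. The lemma is about g, equal to f on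
D, because partial_fst and partial_snd are controlled on D only. *)
Lemma rational_closure_smooth f g : rational_closure D G f ->
  (forall p, D p -> f p = g p) -> smooth_in2 D g.
Proof.
move=> rf fg k; elim: k f g rf fg => [|k IH] f g rf fg.
  by split=> //; exact: rational_closure_continuous rf fg.
have cg := rational_closure_continuous rf fg.
have [_ [fu [fv [rfu rfv df]]]] := rational_closure_C1 rf.
have dg p : D p -> has_partial_fst D g p (fu p) /\ has_partial_snd D g p (fv p).
  case: p => u v Dp; have [f1 f2] := df _ Dp.
  split; [apply: has_derive_in_local f1 _|apply: has_derive_in_local f2 _].
  - exact: fg.
  - by near=> s => /= Ds; split => //; exact: fg.
  - exact: fg.
  - by near=> s => /= Ds; split => //; exact: fg.
have pg p (Dp : D p) := (has_derive_inP (D_fst Dp) (proj1 (dg p Dp)),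
                        has_derive_inP (D_snd Dp) (proj2 (dg p Dp))).
split=> //; split.
- by move=> p Dp; have [[]] := pg p Dp; split => //; case: (pg p Dp) => _ [].
- by apply: IH rfu _ => p Dp; have [[_ <-]] := pg p Dp.
- by apply: IH rfv _ => p Dp; have [_ [_ <-]] := pg p Dp.
Unshelve. all: by end_near. Qed.

End RationalClosure.

(** * The Jacobian of the intersection map *)

Definition taylor_seq (R : realType) (D : set R) (h : R -> R) : nat -> R -> R :=
  fun n t => (n`!%:R)^-1 * derive1n_in D n h t.

Lemma taylor_seqP (R : realType) (D : set R) (h : R -> R) :
  smooth_in D h -> taylor_coefs D (taylor_seq D h).
Proof.
move=> hs n t Dt.
have := has_derive_in_scale (k := (n`!%:R)^-1) (derivable1_inP (hs n t Dt)).
congr has_derive_in; rewrite /taylor_seq factS natrM invfM mulrA mulVKf ?pnatr_eq0//.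
Qed.

Section LineFamily.
Variables (R : realType) (I : set R) (h : R -> R).
Hypothesis I_interval : is_interval I.
Hypothesis I_nondegenerate : I° !=set0.
Hypothesis h_smooth : smooth_in I h.
Implicit Types (u v t : R) (p q : R * R).

Let c := taylor_seq I h.
Let c_taylor : taylor_coefs I c := taylor_seqP h_smooth.

(** h[u^a, v^b] at p = (u, v). *)
Definition hdd (a b : nat) (p : R * R) : R := cdd c a b p.1 p.2.

Lemma hdd_offdiag a b p : p.1 != p.2 ->
  hdd a.+1 b.+1 p = (hdd a b.+1 p - hdd a.+1 b p) / (p.2 - p.1).
Proof. exact: cddSS. Qed.

Lemma hdd_partial_fst (D : set (R * R)) a b p : I p.1 -> I p.2 ->
  (forall s, D (s, p.2) -> I s) ->
  has_partial_fst D (hdd a.+1 b.+1) p (a.+1%:R * hdd a.+2 b.+1 p).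
Proof.
move=> Iu Iv DI.
apply: has_derive_in_local (@cdd_derive_fst _ _ I_interval c a b _ _ c_taylor Iu Iv) _ => //.
by near=> s => /DI.
Unshelve. all: by end_near. Qed.

Lemma hdd_partial_snd (D : set (R * R)) a b p : I p.1 -> I p.2 ->
  (forall s, D (p.1, s) -> I s) ->
  has_partial_snd D (hdd a.+1 b.+1) p (b.+1%:R * hdd a.+1 b.+2 p).
Proof.
move=> Iu Iv DI.
apply: has_derive_in_local (@cdd_derive_snd _ _ I_interval c a b _ _ c_taylor Iu Iv) _ => //.
by near=> s => /DI.
Unshelve. all: by end_near. Qed.

Lemma limit_point_offdiag_fst p : offdiag I p -> limit_point [set s | offdiag I (s, p.2)] p.1.
Proof.
move=> [/= Iu Iv uv].
apply: limit_point_near (limit_point_interval I_interval I_nondegenerate Iu) _.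
have uvn : \forall s \near p.1, s != p.2 by apply: open_nbhs_nbhs; split=> //; exact: open_neq.
by near=> s => Ds; split => //=; near: s.
Unshelve. all: by end_near. Qed.

Lemma limit_point_offdiag_snd p : offdiag I p -> limit_point [set s | offdiag I (p.1, s)] p.2.
Proof.
move=> [/= Iu Iv uv]; rewrite eq_sym in uv.
apply: limit_point_near (limit_point_interval I_interval I_nondegenerate Iv) _.
have uvn : \forall s \near p.2, s != p.1 by apply: open_nbhs_nbhs; split=> //; exact: open_neq.
by near=> s => Ds; split => //=; rewrite eq_sym; near: s.
Unshelve. all: by end_near. Qed.

Lemma partial_fstP f p l : offdiag I p -> has_partial_fst (offdiag I) f p l ->
  derivable_fst_in (offdiag I) f p /\ partial_fst (offdiag I) f p = l.
Proof. by move=> Ip; exact: has_derive_inP (limit_point_offdiag_fst Ip). Qed.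

Lemma partial_sndP f p l : offdiag I p -> has_partial_snd (offdiag I) f p l ->
  derivable_snd_in (offdiag I) f p /\ partial_snd (offdiag I) f p = l.
Proof. by move=> Ip; exact: has_derive_inP (limit_point_offdiag_snd Ip). Qed.

Lemma has_partial_fst_eq f g p l : offdiag I p ->
  (forall q, offdiag I q -> f q = g q) ->
  has_partial_fst (offdiag I) f p l -> has_partial_fst (offdiag I) g p l.
Proof.
move=> Ip fg fl; apply: has_derive_in_local fl _; first exact: fg (_, _) Ip.
by near=> s => Ds; split => //; exact: fg.
Unshelve. all: by end_near. Qed.

Lemma has_partial_snd_eq f g p l : offdiag I p ->
  (forall q, offdiag I q -> f q = g q) ->
  has_partial_snd (offdiag I) f p l -> has_partial_snd (offdiag I) g p l.
Proof.
move=> Ip fg fl; apply: has_derive_in_local fl _; first exact: fg (_, _) Ip.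
by near=> s => Ds; split => //; exact: fg.
Unshelve. all: by end_near. Qed.

Lemma Psi_x_hdd q : offdiag I q -> - hdd 1 1 q = Psi_x h q.
Proof.
case: q => u v [/= Iu Iv uv].
have d0 : u - v != 0 by rewrite subr_eq0.
rewrite hdd_offdiag// /hdd /Psi_x /cdd /c /taylor_seq /= fact0 invr1 !mul1r.
by rewrite -[v - u]opprB; field.
Qed.

Lemma Psi_y_hdd q : offdiag I q -> c 0 q.1 + q.1 * - hdd 1 1 q = Psi_y h q.
Proof.
move=> Iq; rewrite Psi_x_hdd//; case: q Iq => u v [/= Iu Iv uv].
have d0 : u - v != 0 by rewrite subr_eq0.
by rewrite /Psi_x /Psi_y /c /taylor_seq /= fact0 invr1 mul1r; field.
Qed.

(** As y = u x + h(u) = v x + h(v), one finds x + h'(u) = (v - u) x_u and hence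
J = - (v - u) x_u x_v, where x is minus the divided difference h[u, v]. *)
Lemma J_Psi_hdd p : offdiag I p -> Psi_derivable I h p /\
  J_Psi I h p = - (p.2 - p.1) * hdd 1 2 p * hdd 2 1 p.
Proof.
move=> Ip; have [Iu Iv uv] := Ip.
have Ifst s : offdiag I (s, p.2) -> I s by case.
have Isnd s : offdiag I (p.1, s) -> I s by case.
have xu := has_derive_inN (hdd_partial_fst (a := 0%N) (b := 0%N) Iu Iv Ifst).
have xv := has_derive_inN (hdd_partial_snd (a := 0%N) (b := 0%N) Iu Iv Isnd).
have cu : has_derive_in [set s | offdiag I (s, p.2)] (c 0) p.1 (c 1%N p.1).
  have := @c_taylor 0%N _ Iu; rewrite mul1r => cu; apply: has_derive_in_local cu _ => //.
  by near=> s => /Ifst.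
have yu := has_derive_inD cu (has_derive_inM (has_derive_in_id _ p.1) xu).
have yv := has_derive_inD (has_derive_in_cst _ p.2 (c 0 p.1))
  (has_derive_in_scale (k := p.1) xv).
have [dxu {}xu] := partial_fstP Ip (has_partial_fst_eq Ip Psi_x_hdd xu).
have [dxv {}xv] := partial_sndP Ip (has_partial_snd_eq Ip Psi_x_hdd xv).
have [dyu {}yu] := partial_fstP Ip (has_partial_fst_eq Ip Psi_y_hdd yu).
have [dyv {}yv] := partial_sndP Ip (has_partial_snd_eq Ip Psi_y_hdd yv).
split; first by split.
have vu0 : p.2 - p.1 != 0 by rewrite subr_eq0 eq_sym.
rewrite /J_Psi xu xv yu yv -!surjective_pairing (hdd_offdiag 1 0)//.
have -> : hdd 2 0 p = c 1%N p.1 by [].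
by field.
Unshelve. all: by end_near. Qed.

(** * Mixed derivatives of the logarithmic Jacobian *)

(** J_v / J, computed from [J_Psi_hdd]. *)
Definition dlog_J p : R :=
  (p.2 - p.1)^-1 + 2 * hdd 1 3 p / hdd 1 2 p + hdd 2 2 p / hdd 2 1 p.

(** The sum of the mixed derivatives of log |h[u, v^2]| and log |h[u^2, v]|. *)
Definition regular_part p : R :=
  2 * (hdd 2 3 p * hdd 1 2 p - hdd 1 3 p * hdd 2 2 p) / hdd 1 2 p ^+ 2 +
  2 * (hdd 3 2 p * hdd 2 1 p - hdd 2 2 p * hdd 3 1 p) / hdd 2 1 p ^+ 2.

Definition nonsingular p : Prop := hdd 1 2 p != 0 /\ hdd 2 1 p != 0.

Lemma J_Psi_neq0 p : offdiag I p -> nonsingular p -> J_Psi I h p != 0.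
Proof.
move=> Ip [A0 B0]; have [_ ->] := J_Psi_hdd Ip; have [_ _ uv] := Ip.
by rewrite !mulf_neq0// oppr_eq0 subr_eq0 eq_sym.
Qed.

Lemma log_J_partial_snd p : offdiag I p -> nonsingular p ->
  has_partial_snd (offdiag I) (log_J I h) p (dlog_J p).
Proof.
move=> Ip ns; have J0 := J_Psi_neq0 Ip ns; have [Iu Iv uv] := Ip; have [A0 B0] := ns.
have Isnd s : offdiag I (p.1, s) -> I s by case.
set E := [set s | offdiag I (p.1, s)].
have dvu := has_derive_inN
  (has_derive_inB (has_derive_in_id E p.2) (has_derive_in_cst E p.2 p.1)).
have dA := hdd_partial_snd (a := 0%N) (b := 1%N) Iu Iv Isnd.
have dB := hdd_partial_snd (a := 1%N) (b := 0%N) Iu Iv Isnd.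
have dJ := has_derive_inM (has_derive_inM dvu dA) dB.
have vu0 : p.2 - p.1 != 0 by rewrite subr_eq0 eq_sym.
have {}dJ : has_partial_snd (offdiag I) (J_Psi I h) p (J_Psi I h p * dlog_J p).
  apply: (has_partial_snd_eq (f := fun q => - (q.2 - q.1) * hdd 1 2 q * hdd 2 1 q) Ip).
    by move=> q /J_Psi_hdd[_ ->].
  move: dJ; congr has_derive_in; have [_ ->] := J_Psi_hdd Ip.
  by rewrite -!surjective_pairing /dlog_J; field; rewrite vu0 A0 B0.
have := has_derive_in_ln_norm _ dJ; rewrite -surjective_pairing => /(_ J0).
by rewrite mulrAC divff// mul1r.
Qed.

Lemma open_slices (U : set (R * R)) p : open U -> U p ->
  (\forall s \near p.1, U (s, p.2)) /\ (\forall s \near p.2, U (p.1, s)).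
Proof.
move=> oU Up; have /nbhs_ballP[e /= e0 eU] : nbhs p U by exact: open_nbhs_nbhs.
split; apply/nbhs_ballP; exists e => // s ps; apply: eU; split=> //=; exact: ballxx.
Qed.

Lemma dlog_J_partial_fst p : offdiag I p -> nonsingular p ->
  has_partial_fst (offdiag I) dlog_J p (1 / (p.2 - p.1) ^+ 2 + regular_part p).
Proof.
move=> Ip [A0 B0]; have [Iu Iv uv] := Ip.
have Ifst s : offdiag I (s, p.2) -> I s by case.
set E := [set s | offdiag I (s, p.2)].
have vu0 : p.2 - p.1 != 0 by rewrite subr_eq0 eq_sym.
have dvu := has_derive_inB (has_derive_in_cst E p.1 p.2) (has_derive_in_id E p.1).
have d a b := hdd_partial_fst (a := a) (b := b) Iu Iv Ifst.
rewrite /has_partial_fst in d.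
have A0' : hdd 1 2 (p.1, p.2) != 0 by rewrite -surjective_pairing.
have B0' : hdd 2 1 (p.1, p.2) != 0 by rewrite -surjective_pairing.
have := has_derive_inD (has_derive_inD
  (has_derive_inV (f := fun s => p.2 - s) vu0 dvu)
  (has_derive_in_div (g := fun s => hdd 1 2 (s, p.2)) A0'
    (has_derive_in_scale (k := 2) (d 0%N 2%N)) (d 0%N 1%N)))
  (has_derive_in_div (g := fun s => hdd 2 1 (s, p.2)) B0' (d 1%N 1%N) (d 1%N 0%N)).
congr has_derive_in; rewrite -!surjective_pairing /regular_part.
by field; rewrite vu0 A0 B0.
Qed.

(** The open set U is what makes the formula for the inner derivative
available at all points near p, as the outer derivative requires. *)
Lemma S_h_regular_part (U : set (R * R)) p : open U ->
  (forall q, U q -> I q.1 -> I q.2 -> nonsingular q) -> U p -> offdiag I p ->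
  S_h_defined I h p /\ S_h I h p = 1 / (p.2 - p.1) ^+ 2 + regular_part p.
Proof.
move=> oU Uns Up Ip; have [Iu Iv uv] := Ip; have ns := Uns p Up Iu Iv.
have sndE q : offdiag I q -> U q -> derivable_snd_in (offdiag I) (log_J I h) q /\
    partial_snd (offdiag I) (log_J I h) q = dlog_J q.
  by move=> Iq Uq; have [Iq1 Iq2 _] := Iq; apply: partial_sndP => //;
    apply: log_J_partial_snd => //; exact: Uns.
have dS : has_partial_fst (offdiag I) (partial_snd (offdiag I) (log_J I h)) p
    (1 / (p.2 - p.1) ^+ 2 + regular_part p).
  apply: has_derive_in_local (dlog_J_partial_fst Ip ns) _.
    by rewrite -surjective_pairing; have [_ ->] := sndE _ Ip Up.
  have [Us _] := open_slices oU Up.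
  near=> s => /= Is; split=> //.
  have Usv : U (s, p.2) by near: s.
  by have [_ ->] := sndE _ Is Usv.
have [dd e] := partial_fstP Ip dS.
split; last exact: e.
split => //; first exact: J_Psi_neq0.
have : nbhs p U by exact: open_nbhs_nbhs.
move=> /nbhs_ballP[r /= r0 rU]; apply/nbhs_ballP; exists r; first exact: r0.
move=> q pq Iq.
have Uq := rU q pq; have [Iq1 Iq2 _] := Iq.
split; first by have [] := J_Psi_hdd Iq.
  by apply: J_Psi_neq0 => //; exact: Uns.
by have [] := sndE q Iq Uq.
Unshelve. all: by end_near. Qed.

Lemma regular_part_diag t : derive1n_in I 2 h t != 0 -> regular_part (t, t) =
  derive1n_in I 4 h t / (3 * derive1n_in I 2 h t) -
  4 / 9 * (derive1n_in I 3 h t / derive1n_in I 2 h t) ^+ 2.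
Proof.
rewrite /regular_part /hdd !cdd_diag /c /taylor_seq !addSn !add0n.
move: (derive1n_in I 2 h t) (derive1n_in I 3 h t) (derive1n_in I 4 h t) => h2 h3 h4.
by rewrite !factS fact0 => h20; field.
Qed.

Lemma nonsingular_diag t : nonsingular (t, t) <-> derive1n_in I 2 h t != 0.
Proof.
rewrite /nonsingular /hdd !cdd_diag /c /taylor_seq mulf_eq0 invr_eq0 pnatr_eq0 /=.
by split=> // -[].
Qed.

Lemma nonsingular_near t : I t -> derive1n_in I 2 h t != 0 ->
  [set p | (I `*` I) p -> nonsingular p]° (t, t).
Proof.
move=> It /nonsingular_diag[A0 B0].
have near_neq0 a b : hdd a b (t, t) != 0 -> exists2 e : R, 0 < e &
    forall q, ball (t, t) e q -> (I `*` I) q -> hdd a b q != 0.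
  move=> ab0; have nz : nbhs (hdd a b (t, t)) (fun x => x != 0).
    by apply: open_nbhs_nbhs; split=> //; exact: open_neq.
  have /nbhs_ballP[e /= e0 eP] := @cdd_cvg _ _ I_interval c a b t t c_taylor It It _ nz.
  by exists e => // q; exact: eP.
have [d d0 dA] := near_neq0 1%N 2%N A0; have [e e0 eB] := near_neq0 2%N 1%N B0.
apply/nbhs_ballP; exists (Num.min d e) => [|q tq Iq]; first by rewrite /= lt_min d0.
split.
  by apply: dA => //; apply: le_ball tq; rewrite ge_min lexx.
by apply: eB => //; apply: le_ball tq; rewrite ge_min lexx orbT.
Qed.

(** The divided differences of h with both nodes present generate a family
closed under partial derivatives, and the two denominators in [regular_part] are
the divided differences that [nonsingular] keeps away from zero. *)
Lemma regular_part_smooth (W : set (R * R)) :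
  (forall p, W p -> [/\ I p.1, I p.2 & nonsingular p]) ->
  (forall p, W p -> limit_point [set s | W (s, p.2)] p.1) ->
  (forall p, W p -> limit_point [set s | W (p.1, s)] p.2) ->
  smooth_in2 W regular_part.
Proof.
move=> WI Wfst Wsnd.
pose G := [set f | exists a b, f = hdd a.+1 b.+1].
have rG a b : rational_closure W G (hdd a.+1 b.+1) by apply: rc_gen; exists a, b.
have GC1 f : G f -> C1_in_closure W G f.
  move=> [a [b ->]]; split.
    move=> [u v] /WI[/= Iu Iv _] P cP.
    have /nbhs_ballP[e /= e0 eP] :=
      @cdd_cvg _ _ I_interval c a.+1 b.+1 u v c_taylor Iu Iv P cP.
    by apply/nbhs_ballP; exists e => // q pq /WI[Iq1 Iq2 _]; exact: eP.
  exists (fun p => a.+1%:R * hdd a.+2 b.+1 p), (fun p => b.+1%:R * hdd a.+1 b.+2 p).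
  have rscale (k : R) a' b' :
      rational_closure W G (fun p => k * hdd a'.+1 b'.+1 p).
    by apply: rc_mul; [exact: rc_cst|exact: rG].
  split; [exact: rscale|exact: rscale|].
  move=> p /WI[Iu Iv _]; split.
    by apply: hdd_partial_fst => // s /WI[].
  by apply: hdd_partial_snd => // s /WI[].
have rA : rational_closure W G (fun p => (hdd 1 2 p)^-1).
  by apply: rc_inv => // p /WI[_ _ []].
have rB : rational_closure W G (fun p => (hdd 2 1 p)^-1).
  by apply: rc_inv => // p /WI[_ _ []].
have rterm (f1 f2 f3 f4 g : R * R -> R) :
    rational_closure W G f1 -> rational_closure W G f2 -> rational_closure W G f3 ->
    rational_closure W G f4 -> rational_closure W G g ->
    rational_closure W G (fun p => 2 * (f1 p * f2 p + -1 * (f3 p * f4 p)) * (g p * g p)).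
  move=> *; apply: rc_mul; last exact: rc_mul.
  apply: rc_mul; first exact: rc_cst.
  by apply: rc_add; [exact: rc_mul|apply: rc_mul; [exact: rc_cst|exact: rc_mul]].
apply: (rational_closure_smooth Wfst Wsnd GC1 (rc_add
  (rterm _ _ _ _ _ (rG 1%N 2%N) (rG 0%N 1%N) (rG 0%N 2%N) (rG 1%N 1%N) rA)
  (rterm _ _ _ _ _ (rG 2%N 1%N) (rG 1%N 0%N) (rG 1%N 1%N) (rG 2%N 0%N) rB)))
  => p /WI[_ _ [A0 B0]].
by rewrite /regular_part; field; rewrite A0 B0.
Qed.

End LineFamily.

Theorem theorem1p1 (R : realType) (I : set R) (h : R -> R) (t0 : R)
    (I_interval : is_interval I) (I_nondegenerate : I° !=set0)
    (h_smooth : smooth_in I h)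
    (I_t0 : I t0) (h2_t0 : derive1n_in I 2 h t0 != 0) :
  exists (W : set (R * R)) (R_h : R * R -> R),
    [/\ exists2 U : set (R * R), open_nbhs (t0, t0) U & W = U `&` (I `*` I),
        forall t, W (t, t) -> derive1n_in I 2 h t != 0,
        smooth_in2 W R_h,
        forall u v, W (u, v) -> u != v ->
          S_h_defined I h (u, v) /\
          S_h I h (u, v) = 1 / (v - u) ^+ 2 + R_h (u, v)
      & forall t, W (t, t) ->
          R_h (t, t) =
            derive1n_in I 4 h t / (3 * derive1n_in I 2 h t) -
            4 / 9 * (derive1n_in I 3 h t / derive1n_in I 2 h t) ^+ 2].
Proof.
(* The interior is taken in the plane, hence the implication: points outside
I x I impose nothing. *)
pose U := [set p | (I `*` I) p -> nonsingular I h p]°.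
have oU : open U by exact: open_interior.
have UW p : (U `&` (I `*` I)) p -> [/\ I p.1, I p.2 & nonsingular I h p].
  by move=> [/interior_subset H [I1 I2]]; split => //; exact: H.
have Udiag t : (U `&` (I `*` I)) (t, t) -> I t /\ derive1n_in I 2 h t != 0.
  by move=> /UW[/= It _ /nonsingular_diag].
exists (U `&` (I `*` I)), (regular_part I h); split.
- exists U => //; split => //.
  exact: nonsingular_near.
- by move=> t /Udiag[].
- apply: regular_part_smooth => // p [Up [I1 I2]].
    apply: limit_point_near (limit_point_interval I_interval I_nondegenerate I1) _.
    have [Us _] := open_slices oU Up.
    by near=> s => Is; split => //; near: s.
  apply: limit_point_near (limit_point_interval I_interval I_nondegenerate I2) _.
  have [_ Us] := open_slices oU Up.
  by near=> s => Is; split => //; near: s.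
- move=> u v [Uuv [/= Iu Iv]] uv.
  apply: (S_h_regular_part (p := (u, v)) I_interval I_nondegenerate h_smooth oU) => //.
  by move=> q Uq I1 I2; have [] := UW q.
- by move=> t /Udiag[_ h2]; exact: regular_part_diag.
Unshelve. all: by end_near. Qed.
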